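(* Let $\{X_t\}_{t\ge0}$ be a free Brownian motion in a non-commutative probability space $(\mathcal A,\varphi)$, considered on $[0,T]$ as a $\gamma$-Hölder path with $\gamma\in(\frac13,\frac12]$. Let $\mathcal J^I$ and $\mathcal J^S$ be the integrals associated with the Itô and Stratonovich product Lévy areas $\mathbf X^I$, $\mathbf X^S$. Denote by $\mathrm{Id}\times\varphi\times\mathrm{Id}$ the continuous extension of $(\mathrm{Id}\times\varphi\times\mathrm{Id})(U_1\otimes U_2\otimes U_3):=\varphi(U_2)U_1U_3$ to $\mathcal A^{\hat\otimes3}$. Then for any $\mathbf U\in\mathbf Q(X)$ with decomposition $(\delta\mathbf U)_{st}=(\delta X)_{st}\sharp\mathbb U^{X,1}_s+\mathbb U^{X,2}_s\sharp(\delta X)_{st}+\mathbf U^\flat_{st}$, and all $s<t$, $$\mathcal J^S_{st}(\mathbf U\sharp dX)=\mathcal J^I_{st}(\mathbf U\sharp dX)+\frac12\int_s^t(\mathrm{Id}\times\varphi\times\mathrm{Id})[\mathbb U^{X,1}_u+\mathbb U^{X,2}_u]\,du.$$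
   Context: A non-commutative probability space $(\mathcal A,\varphi)$ is a von Neumann algebra $\mathcal A$ with a unital, weakly continuous, positive, faithful, tracial linear functional $\varphi$; $\|\cdot\|$ is the operator norm. A free Brownian motion is a family $\{X_t\}_{t\ge0}$ of self-adjoint elements with $X_0=0$, freely independent disjoint increments, and $\frac1{\sqrt{t-s}}(X_t-X_s)$ distributed as the standard semicircular law for $s<t$. Tensor products. $(U_1\otimes U_2)\cdot(V_1\otimes V_2)=(U_1V_1)\otimes(V_2U_2)$, $(U\otimes V)^*=V^*\otimes U^*$. $\hat\otimes$ is the projective tensor product; $L^\infty(\varphi\otimes\varphi)$ is the spatial (von Neumann algebra) tensor product. $(U_1\otimes U_2)\sharp X:=U_1XU_2$, $X\sharp(U_1\otimes U_2\otimes U_3):=(U_1XU_2)\otimes U_3$, $(U_1\otimes U_2\otimes U_3)\sharp X:=U_1\otimes(U_2XU_3)$, extended by continuity. $\mathrm{Id}\times\varphi$ is the continuous extension of $U\otimes V\mapsto\varphi(V)U$. Filtration. $\mathcal A_t$ is the (norm-closed) unital subalgebra generated by $\{X_s\}_{s\le t}$. A biprocess (resp. triprocess) $Y$ is adapted if $Y_t\in\mathcal A_t\hat\otimes\mathcal A_t$ (resp. $\mathcal A_t^{\hat\otimes3}$) for all $t$. Itô integral (Biane–Speicher). A simple adapted biprocess is $\mathbf U=\sum_jA^j\otimes B^j$ with $A^j,B^j$ step processes, constant on $[t_i,t_{i+1})$ with values $A^j_{t_i},B^j_{t_i}\in\mathcal A_{t_i}$ for some times $t_1<\dots<t_m$ and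 zero outside $[t_1,t_m)$; $\int_0^\infty\mathbf U_u\sharp dX_u:=\sum_j\sum_kA^j_{t_k}(X_{t_{k+1}}-X_{t_k})B^j_{t_k}$. It is known that $\|\int_0^\infty\mathbf U_u\sharp dX_u\|^2\le8\int_0^\infty\|\mathbf U_u\|^2_{L^\infty(\varphi\otimes\varphi)}du$, and the integral is extended to the completion for the norm on the right. For $\mathbf V\in\mathcal A_s\hat\otimes\mathcal A_s$: $\mathbf X^I_{st}[\mathbf V]:=\int_s^t(\mathbf V\sharp(\delta X)_{su})\cdot dX_u$ (the Itô integral of $u\mapsto[\mathbf V\sharp(\delta X)_{su}]\otimes1$ on $[s,t]$) and $\mathbf X^S_{st}[\mathbf V]:=\mathbf X^I_{st}[\mathbf V]+\frac12(t-s)(\mathrm{Id}\times\varphi)[\mathbf V]$. Hölder spaces. For a Banach space $V$, $\mathcal C_k(V)$ ($k=1,2,3$) is the set of continuous $V$-valued maps on $\{(t_1,\dots,t_k)\in[0,T]^k:t_1\le\dots\le t_k\}$ vanishing when two of the times are equal. $(\delta g)_{st}:=g_t-g_s$; $(\delta h)_{sut}:=h_{st}-h_{su}-h_{ut}$ for $h\in\mathcal C_2$ (also denoted $\delta_2$). $\mathcal C_1^\alpha,\mathcal C_2^\alpha,\mathcal C_3^{(\alpha,\beta)}$: finiteness of $\sup_{s<t}\|(\delta h)_{st}\|/|t-s|^\alpha$, $\sup_{s<t}\|h_{st}\|/|t-s|^\alpha$, $\sup_{s<u<t}\|h_{sut}\|/(|t-u|^\alpha|u-s|^\beta)$ respectively.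 $\mathcal C_3^\mu$: finite sums of elements of $\mathcal C_3^{(\alpha,\mu-\alpha)}$, $0\le\alpha\le\mu$. Sewing map: for $\mu>1$ and $h\in\mathcal C_3^\mu(V)\cap\mathrm{Im}\,\delta_2$, $\Lambda h$ is the unique element of $\mathcal C_2^\mu(V)$ with $\delta(\Lambda h)=h$. $\mathbf Q(X)$: adapted biprocesses $\mathbf U\in\mathcal C_1^\gamma(\mathcal A\hat\otimes\mathcal A)$ with decomposition as in the claim, $\mathbb U^{X,i}\in\mathcal C_1^\gamma(\mathcal A^{\hat\otimes3})$ adapted triprocesses, $\mathbf U^\flat\in\mathcal C_2^{2\gamma}(\mathcal A\hat\otimes\mathcal A)$. For $\mathbf X\in\{\mathbf X^I,\mathbf X^S\}$, with $\mathbf X^*_{st}[\mathbf V]:=\mathbf X_{st}[\mathbf V^*]^*$, $[\mathbf X_{st}\times\mathrm{Id}](U_1\otimes U_2\otimes U_3):=\mathbf X_{st}[U_1\otimes U_2]\cdot U_3$, $[\mathrm{Id}\times\mathbf X^*_{st}](U_1\otimes U_2\otimes U_3):=U_1\cdot\mathbf X^*_{st}[U_2\otimes U_3]$ (extended continuously), the associated integral is $\mathcal J_{st}(\mathbf U\sharp dX):=M_{st}-\Lambda_{st}(\delta M)$, $M_{st}:=\mathbf U_s\sharp(\delta X)_{st}+[\mathbf X_{st}\times\mathrm{Id}](\mathbb U^{X,1}_s)+[\mathrm{Id}\times\mathbf X^*_{st}](\mathbb U^{X,2}_s)$ (well-defined). *)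

(* Defs.v *)
From HB Require Import structures.
From mathcomp Require Import all_boot all_order all_algebra sesquilinear.
From mathcomp Require Import all_classical all_reals all_analysis.
From mathcomp Require Import complex.

Set Implicit Arguments.
Unset Strict Implicit.
Unset Printing Implicit Defensive.

Import Order.TTheory GRing.Theory Num.Theory numFieldNormedType.Exports.

Local Open Scope classical_set_scope.
Local Open Scope ring_scope.
Local Open Scope complex_scope.

(** Norms of complex Banach spaces take values in [R[i]]; they are compared with
    real numbers through [%:C]. *)

(** Unital C*-algebras.  The library hierarchy has no join of normed modules
    and rings, hence a multiplication [amul] separate from [*]. *)
HB.mixin Record isCstar (K : numClosedFieldType) A of CompleteNormedModule K A := {
  amul : A -> A -> A;
  aone : A;
  star : A -> A;
  amulA : associative amul;
  amul1l : left_id aone amul;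
  amul1r : right_id aone amul;
  amulDl : left_distributive amul +%R;
  amulDr : right_distributive amul +%R;
  amulZl : forall (k : K) (a b : A), amul (k *: a) b = k *: amul a b;
  amulZr : forall (k : K) (a b : A), amul a (k *: b) = k *: amul a b;
  starD : {morph star : a b / a + b};
  starZ : forall (k : K) (a : A), star (k *: a) = Num.conj k *: star a;
  starM : forall a b : A, star (amul a b) = amul (star b) (star a);
  starK : involutive star;
  normM_le : forall a b : A, `|amul a b| <= `|a| * `|b|;
  normCstar : forall a : A, `|amul (star a) a| = `|a| ^+ 2
}.

#[short(type="cstarType")]
HB.structure Definition Cstar (K : numClosedFieldType) :=
  {A of CompleteNormedModule K A & isCstar K A}.

Declare Scope cstar_scope.
Delimit Scope cstar_scope with cstar.
Notation "a ∙ b" := (amul a b)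
  (at level 40, left associativity) : cstar_scope.
Local Open Scope cstar_scope.

Definition apow (K : numClosedFieldType) (A : cstarType K) (a : A) (n : nat) : A :=
  iter n (amul a) aone.

Definition apoly (K : numClosedFieldType) (A : cstarType K) (p : {poly K}) (a : A) : A :=
  \sum_(i < size p) p`_i *: apow a i.

Record hilbert (R : realType) := Hilbert {
  hcar :> completeNormedModType R[i];
  (** linear in the first argument *)
  ip : {dot hcar for (@Num.conj R[i])};
  ip_norm : forall x : hcar, ip x x = `|x| ^+ 2
}.

(** [pi] realizes [A] isometrically as a unital *-algebra of bounded operators
    on [H], closed in the weak operator topology. *)
Record vN_representation (R : realType) (A : cstarType R[i]) (H : hilbert R)
    (pi : A -> H -> H) : Prop := {
  rep_linear : forall a, linear (pi a);
  rep_linearl : forall k a b x, pi (k *: a + b) x = k *: pi a x + pi b x;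
  rep_mul : forall a b x, pi (a ∙ b) x = pi a (pi b x);
  rep_one : forall x, pi aone x = x;
  rep_star : forall a x y, ip H (pi (star a) x) y = ip H x (pi a y);
  rep_bounded : forall a x, `|pi a x| <= `|a| * `|x|;
  rep_isometric : forall a (c : R), (forall x, `|pi a x| <= c%:C * `|x|) ->
    0 <= c -> `|a| <= c%:C;
  rep_wot_closed : forall T : H -> H, linear T -> continuous T ->
    (forall (n : nat) (x y : nat -> H) (e : R), 0 < e -> exists a : A,
       forall k, (k < n)%N -> `|ip H (pi a (x k) - T (x k)) (y k)| < e%:C) ->
    exists a : A, forall x, pi a x = T x
}.

(** Continuity of [phi] for the ultraweak (sigma-weak) topology, i.e. the
    initial topology of the functionals [a |-> \sum_n <a xi_n, eta_n>] with
    [xi], [eta] square-summable. *)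
Definition square_summable (R : realType) (H : hilbert R) (x : nat -> H) :=
  exists c : R, forall n, \sum_(k < n) `|x k| ^+ 2 <= c%:C.

Definition ultraweak_functional (R : realType) (A : cstarType R[i])
    (H : hilbert R) (pi : A -> H -> H) (x y : nat -> H) (a : A) : R[i]^o :=
  limn (series (fun n => ip H (pi a (x n)) (y n) : R[i]^o)).

Definition ultraweakly_continuous (R : realType) (A : cstarType R[i])
    (H : hilbert R) (pi : A -> H -> H) (phi : A -> R[i]^o) :=
  forall (F : set_system A) (a : A), ProperFilter F ->
    (forall x y : nat -> H, square_summable x -> square_summable y ->
       ultraweak_functional pi x y @ F --> ultraweak_functional pi x y a) ->
    phi @ F --> phi a.

Record ncps (R : realType) := NCPS {
  nalg :> cstarType R[i];
  nhilb : hilbert R;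
  nrep : nalg -> nhilb -> nhilb;
  nrepP : vN_representation nrep;
  phi : {linear nalg -> R[i]^o};
  phi_unital : phi aone = 1;
  phi_normal : ultraweakly_continuous nrep phi;
  phi_positive : forall a, (0 : R[i]) <= phi (star a ∙ a);
  phi_faithful : forall a, phi (star a ∙ a) = 0 -> a = 0;
  phi_tracial : forall a b, phi (a ∙ b) = phi (b ∙ a)
}.

Section FreeBrownianMotion.
Variables (R : realType) (A : ncps R).

(** Freeness of (the unital algebras generated by) [a 0], ..., [a (n - 1)]. *)
Definition freely_independent (n : nat) (a : nat -> A) :=
  forall (m : nat) (l : nat -> nat) (p : nat -> {poly R[i]}),
    (0 < m)%N ->
    (forall k, (k < m)%N -> (l k < n)%N) ->
    (forall k, (k.+1 < m)%N -> l k != l k.+1) ->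
    (forall k, (k < m)%N -> phi A (apoly (p k) (a (l k))) = 0) ->
    phi A (\big[amul/aone]_(k < m) apoly (p k) (a (l k))) = 0.

(** The moments determine the law of a self-adjoint element. *)
Definition standard_semicircular (a : A) :=
  forall n : nat, phi A (apow a n) =
    (\int[@lebesgue_measure R]_(x in `[(-2)%R, 2%R])
       (x ^+ n * (Num.sqrt (4 - x ^+ 2) / (2 * pi))))%:C.

Record free_brownian_motion (X : R -> A) : Prop := {
  fbm_selfadjoint : forall t, 0 <= t -> star (X t) = X t;
  fbm0 : X 0 = 0;
  fbm_free : forall (n : nat) (t : nat -> R), 0 <= t 0%N ->
    (forall k, (k < n)%N -> t k < t k.+1) ->
    freely_independent n (fun k => X (t k.+1) - X (t k));
  fbm_law : forall s t, 0 <= s -> s < t ->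
    standard_semicircular ((Num.sqrt (t - s))^-1%:C *: (X t - X s))
}.

(** Norm-closed unital subalgebra generated by [X s], [0 <= s <= t]. *)
Definition unital_subalgebra (B : set A) :=
  [/\ B aone, (forall (k : R[i]) a b, B a -> B b -> B (k *: a + b))
    & forall a b, B a -> B b -> B (a ∙ b)].

Definition filtration (X : R -> A) (t : R) : set A :=
  [set a | forall B : set A, closed B -> unital_subalgebra B ->
     (forall s, 0 <= s <= t -> B (X s)) -> B a].

End FreeBrownianMotion.

(** Universal property: bounded bilinear maps factor uniquely through [tens],
    with the same bound. *)
Record projective_tensor (R : realType) (V W : completeNormedModType R[i]) :=
  ProjectiveTensor {
  pcar :> completeNormedModType R[i];
  tens : {bilinear V -> W -> pcar};
  tens_norm : forall v w, `|tens v w| <= `|v| * `|w|;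
  tens_universal : forall (Z : completeNormedModType R[i])
      (f : {bilinear V -> W -> Z}) (c : R),
    (forall v w, `|f v w| <= c%:C * (`|v| * `|w|)) ->
    exists L : {linear pcar -> Z},
      [/\ forall v w, L (tens v w) = f v w,
          0 <= c -> forall z, `|L z| <= c%:C * `|z|
        & forall L' : {linear pcar -> Z}, continuous L' ->
            (forall v w, L' (tens v w) = f v w) -> L' =1 L]
}.

Section Tensors.
Variables (R : realType) (A : ncps R).
Variables (A2 : projective_tensor A A) (A3 : projective_tensor A2 A).

Definition tens2 (a b : A) : A2 := tens A2 a b.
Definition tens3 (a b c : A) : A3 := tens A3 (tens2 a b) c.

(** The continuous extension of [a ⊗ b |-> f a b].  It is only required to be
    additive so as to cover the conjugate-linear involution; scalars can always
    be absorbed in [a] or [b]. *)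
Definition ext2 (Z : completeNormedModType R[i]) (f : A -> A -> Z) : A2 -> Z :=
  xget (fun=> 0) [set L : A2 -> Z | [/\ {morph L : x y / x + y}, continuous L
                            & forall a b, L (tens2 a b) = f a b]].

Definition ext3 (Z : completeNormedModType R[i]) (f : A -> A -> A -> Z) : A3 -> Z :=
  xget (fun=> 0) [set L : A3 -> Z | [/\ {morph L : x y / x + y}, continuous L
                            & forall a b c, L (tens3 a b c) = f a b c]].

Definition sharp2 (U : A2) (x : A) : A := ext2 (fun a b => a ∙ x ∙ b) U.

Definition lsharp3 (x : A) (U : A3) : A2 :=
  ext3 (fun a b c => tens2 (a ∙ x ∙ b) c) U.

Definition rsharp3 (U : A3) (x : A) : A2 :=
  ext3 (fun a b c => tens2 a (b ∙ x ∙ c)) U.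

Definition star2 (U : A2) : A2 := ext2 (fun a b => tens2 (star b) (star a)) U.

Definition id_phi (U : A2) : A := ext2 (fun a b => (phi A b : R[i]) *: a) U.

Definition id_phi_id (U : A3) : A :=
  ext3 (fun a b c => (phi A b : R[i]) *: (a ∙ c)) U.

(** For a closed subalgebra [B], the elements [z] of [B ⊗^ B] (resp. of
    [B ⊗^ B ⊗^ B]) having a representation as an absolutely convergent series
    of elementary tensors of [B] of total mass at most [r]; the projective norm
    of [z] is the infimum of these [r]. *)
Definition series_rep2 (B : set A) (r : R) (z : A2) :=
  exists a b : nat -> A,
    [/\ forall n, B (a n) /\ B (b n),
        forall n, \sum_(k < n) `|a k| * `|b k| <= r%:C
      & series (fun n => tens2 (a n) (b n)) @ \oo --> z].

Definition series_rep3 (B : set A) (r : R) (z : A3) :=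
  exists a b c : nat -> A,
    [/\ forall n, [/\ B (a n), B (b n) & B (c n)],
        forall n, \sum_(k < n) `|a k| * `|b k| * `|c k| <= r%:C
      & series (fun n => tens3 (a n) (b n) (c n)) @ \oo --> z].

Definition hat2 (B : set A) : set A2 := [set z | exists r, series_rep2 B r z].
Definition hat3 (B : set A) : set A3 := [set z | exists r, series_rep3 B r z].

(** [E] is, on [B ⊗^ B ⊗^ B], the continuous linear extension of
    [a ⊗ b ⊗ c |-> f a b c]. *)
Definition extends_on (B : set A) (f : A -> A -> A -> A) (E : A3 -> A) :=
  [/\ forall (k : R[i]) y z, hat3 B y -> hat3 B z -> E (k *: y + z) = k *: E y + E z,
      exists c : R, forall r z, series_rep3 B r z -> `|E z| <= (c * r)%:C
    & forall a b c, B a -> B b -> B c -> E (tens3 a b c) = f a b c].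

End Tensors.

Section Ito.
Variables (R : realType) (A : ncps R).

(** A formal sum [\sum_i a_i ⊗ b_i], as a list of pairs. *)
Definition formal := seq (A * A).

(** Spatial norm of [A ⊗ A^op]: [a ⊗ b] acts on [H ⊗ conj H] by
    [x ⊗ conj y |-> (a x) ⊗ conj (b^* y)], so that the composition of these
    operators is the product [(U1 ⊗ U2)(V1 ⊗ V2) = U1 V1 ⊗ V2 U2]. *)
Definition hs_normsq (w : seq (nhilb A * nhilb A)) : R[i] :=
  \sum_(p <- w) \sum_(q <- w)
    ip (nhilb A) p.1 q.1 * Num.conj (ip (nhilb A) p.2 q.2).

Definition hs_act (z : formal) (w : seq (nhilb A * nhilb A)) :=
  [seq (nrep p.1 q.1, nrep (star p.2) q.2) | p <- z, q <- w].

Definition Linfty_norm (z : formal) : \bar R :=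
  ereal_sup [set (Num.sqrt (complex.Re (hs_normsq (hs_act z w))))%:E
            | w in [set w | hs_normsq w <= 1]].

(** [\sum_(j < J) A^j ⊗ B^j], with [A^j], [B^j] constant equal to
    [sb_A j k], [sb_B j k] on [[t_k, t_{k+1})] for [k < sb_m], and zero outside
    [[t_0, t_{sb_m})]. *)
Record simple_biprocess := SimpleBiprocess {
  sb_m : nat;
  sb_t : nat -> R;
  sb_J : nat;
  sb_A : nat -> nat -> A;
  sb_B : nat -> nat -> A
}.

Definition adapted_simple (X : R -> A) (S : simple_biprocess) :=
  [/\ 0 <= sb_t S 0%N,
      forall k, (k < sb_m S)%N -> sb_t S k < sb_t S k.+1
    & forall j k, (j < sb_J S)%N -> (k < sb_m S)%N ->
        filtration X (sb_t S k) (sb_A S j k) /\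
        filtration X (sb_t S k) (sb_B S j k)].

Definition step_value (S : simple_biprocess) (a : nat -> A) (u : R) : A :=
  \sum_(k < sb_m S | sb_t S k <= u < sb_t S k.+1) a k.

Definition sb_value (S : simple_biprocess) (u : R) : formal :=
  [seq (step_value S (sb_A S j) u, step_value S (sb_B S j) u) | j <- iota 0 (sb_J S)].

Definition sb_integral (X : R -> A) (S : simple_biprocess) : A :=
  \sum_(j < sb_J S) \sum_(k < sb_m S)
    sb_A S j k ∙ (X (sb_t S k.+1) - X (sb_t S k)) ∙ sb_B S j k.

Definition formal_sub (z z' : formal) : formal :=
  z ++ [seq (- p.1, p.2) | p <- z'].

Definition approximates (X : R -> A) (U : R -> formal) (S : nat -> simple_biprocess) :=
  (forall n, adapted_simple X (S n)) /\
  ((fun n => \int[@lebesgue_measure R]_(u in `[0%R, +oo[)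
     (Linfty_norm (formal_sub (sb_value (S n) u) (U u)) ^+ 2))%E @ \oo --> 0%E).

(** [Y] is the value at [U] of the extension by continuity of the integral of
    simple adapted biprocesses. *)
Definition is_ito_integral (X : R -> A) (U : R -> formal) (Y : A) :=
  (exists S, approximates X U S) /\
  forall S, approximates X U S -> (fun n => sb_integral X (S n)) @ \oo --> Y.

End Ito.

Section Hoelder.
Variables (R : realType) (T : R) (V : completeNormedModType R[i]).

Definition simplex2 : set (R * R) :=
  [set p | [/\ 0 <= p.1, p.1 <= p.2 & p.2 <= T]].
Definition simplex3 : set (R * R * R) :=
  [set p | [/\ 0 <= p.1.1, p.1.1 <= p.1.2, p.1.2 <= p.2 & p.2 <= T]].

Definition C1 (g : R -> V) := {within `[0, T], continuous g}.

Definition C2 (h : R -> R -> V) :=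
  {within simplex2, continuous (fun p => h p.1 p.2)} /\
  forall s, 0 <= s <= T -> h s s = 0.

Definition C3 (h : R -> R -> R -> V) :=
  {within simplex3, continuous (fun p => h p.1.1 p.1.2 p.2)} /\
  forall s t, simplex2 (s, t) -> h s s t = 0 /\ h s t t = 0.

Definition delta1 (g : R -> V) (s t : R) : V := g t - g s.
Definition delta2 (h : R -> R -> V) (s u t : R) : V := h s t - h s u - h u t.

Definition C1_holder (al : R) (g : R -> V) :=
  C1 g /\ exists c : R, forall s t, 0 <= s -> s < t -> t <= T ->
    `|delta1 g s t| <= (c * (t - s) `^ al)%:C.

Definition C2_holder (al : R) (h : R -> R -> V) :=
  C2 h /\ exists c : R, forall s t, 0 <= s -> s < t -> t <= T ->
    `|h s t| <= (c * (t - s) `^ al)%:C.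

Definition C3_holder2 (al be : R) (h : R -> R -> R -> V) :=
  C3 h /\ exists c : R, forall s u t, 0 <= s -> s < u -> u < t -> t <= T ->
    `|h s u t| <= (c * ((t - u) `^ al * (u - s) `^ be))%:C.

Definition C3_holder (mu : R) (h : R -> R -> R -> V) :=
  exists (n : nat) (al : nat -> R) (f : nat -> R -> R -> R -> V),
    (forall i, (i < n)%N -> 0 <= al i <= mu /\ C3_holder2 (al i) (mu - al i) (f i)) /\
    forall s u t, simplex3 (s, u, t) -> h s u t = \sum_(i < n) f i s u t.

(** [L = Lambda h]. *)
Definition is_sewing (h : R -> R -> R -> V) (L : R -> R -> V) :=
  exists mu : R, 1 < mu /\
    [/\ C3_holder mu h,
        exists2 g, C2 g & forall s u t, simplex3 (s, u, t) -> delta2 g s u t = h s u t,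
        C2_holder mu L
      & forall s u t, simplex3 (s, u, t) -> delta2 L s u t = h s u t].

(** Riemann integral of a Banach-valued function: limit of the Riemann sums
    over tagged partitions [(p, c)] of [[s, t]] as the mesh goes to 0. *)
Definition is_riemann_integral (f : R -> V) (s t : R) (I : V) :=
  forall e : R, 0 < e -> exists2 d : R, 0 < d &
    forall (n : nat) (p c : nat -> R), p 0%N = s -> p n = t ->
      (forall k, (k < n)%N -> p k <= c k <= p k.+1 /\ p k.+1 - p k < d) ->
      `|\sum_(k < n) (p k.+1 - p k)%:C *: f (c k) - I| < e%:C.

Definition riemann_integral (f : R -> V) (s t : R) : V :=
  xget 0 (is_riemann_integral f s t).

End Hoelder.

Section RoughIntegral.
Variables (R : realType) (A : ncps R).
Variables (A2 : projective_tensor A A) (A3 : projective_tensor A2 A).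
Variables (X : R -> A) (T gamma : R).

Definition adapted2 (U : R -> A2) :=
  forall t, 0 <= t <= T -> hat2 (filtration X t) (U t).
Definition adapted3 (U : R -> A3) :=
  forall t, 0 <= t <= T -> hat3 (filtration X t) (U t).

(** [U] belongs to Q(X), with decomposition [(U1, U2, Uflat)]. *)
Record controlled (U : R -> A2) (U1 U2 : R -> A3) (Uflat : R -> R -> A2) : Prop := {
  ctl_adapted : adapted2 U;
  ctl_holder : C1_holder T gamma U;
  ctl_adapted1 : adapted3 U1;
  ctl_holder1 : C1_holder T gamma U1;
  ctl_adapted2 : adapted3 U2;
  ctl_holder2 : C1_holder T gamma U2;
  ctl_flat : C2_holder T (2 * gamma) Uflat;
  ctl_decomposition : forall s t, 0 <= s -> s <= t -> t <= T ->
    delta1 U s t = lsharp3 (delta1 X s t) (U1 s) + rsharp3 (U2 s) (delta1 X s t)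
                   + Uflat s t
}.

(** [XI s t V] is the Ito integral of [u |-> (V # (X u - X s)) ⊗ 1] over
    [[s, t]], for [V] in [A_s ⊗^ A_s]. *)
Definition ito_area (XI : R -> R -> A2 -> A) :=
  forall s t V, 0 <= s -> s <= t -> t <= T -> hat2 (filtration X s) V ->
    is_ito_integral X
      (fun u => if s <= u <= t then [:: (sharp2 V (delta1 X s u), aone)] else [::])
      (XI s t V).

Definition strat_area (XI : R -> R -> A2 -> A) (s t : R) (V : A2) : A :=
  XI s t V + ((t - s) / 2)%:C *: id_phi V.

Definition area_star (XX : R -> R -> A2 -> A) (s t : R) (V : A2) : A :=
  star (XX s t (star2 V)).

(** [J] is a value of the integral of [U # dX] associated with the product Levy
    area [XX] (it is unique, as [E1], [E2] and [L] are); [E1 s t] and [E2 s t] are the extensions [XX_st x Id] and [Id x XX^*_st]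
    to [A_s ⊗^ A_s ⊗^ A_s]. *)
Definition is_rough_integral (XX : R -> R -> A2 -> A)
    (U : R -> A2) (U1 U2 : R -> A3) (J : R -> R -> A) :=
  exists (E1 E2 : R -> R -> A3 -> A) (L : R -> R -> A),
    let M s t := sharp2 (U s) (delta1 X s t) + E1 s t (U1 s) + E2 s t (U2 s) in
    [/\ forall s t, 0 <= s -> s <= t -> t <= T ->
          extends_on (filtration X s) (fun a b c => XX s t (tens2 A2 a b) ∙ c) (E1 s t),
        forall s t, 0 <= s -> s <= t -> t <= T ->
          extends_on (filtration X s) (fun a b c => a ∙ area_star XX s t (tens2 A2 b c))
            (E2 s t),
        is_sewing T (delta2 M) L
      & forall s t, 0 <= s -> s <= t -> t <= T -> J s t = M s t - L s t].

End RoughIntegral.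

(* Main.v *)
(** The Levy areas differ by [(t - s) / 2 * id_phi], so on elementary tensors,
    and by density everywhere, both extensions [XX x Id] and [Id x XX^*] change
    by [(t - s) / 2 * id_phi_id].  The two integrals are additive in the
    interval; hence [J^S - J^I] is additive and equals
    [(t - s) / 2 * id_phi_id (U1 s + U2 s)] up to the two sewing corrections,
    which are [o(t - s)], and this forces it to be half of the Riemann integral.
    Existence of the continuous extensions rests on the norm continuity of
    [phi], deduced here from its ultraweak continuity. *)

Require Import Defs.
From HB Require Import structures.
From mathcomp Require Import all_boot all_order all_algebra sesquilinear.
From mathcomp Require Import all_classical all_reals all_analysis.
From mathcomp Require Import complex ring.

Set Implicit Arguments.
Unset Strict Implicit.
Unset Printing Implicit Defensive.

Import Order.TTheory GRing.Theory Num.Theory numFieldNormedType.Exports.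

Local Open Scope classical_set_scope.
Local Open Scope ring_scope.
Local Open Scope complex_scope.
Local Open Scope cstar_scope.

(** [V] with scalars acting through their conjugates, so that the
    conjugate-linear maps into [V] are the linear maps into [conj_space V]. *)
Definition conj_space (K : numClosedFieldType) (V : completeNormedModType K) : Type := V.

(** * Conjugate Banach spaces *)

Section ConjSpace.
Variables (K : numClosedFieldType) (V : completeNormedModType K).
Local Notation V' := (conj_space V).

HB.instance Definition _ := CompletePseudoMetric.copy V' V.
HB.instance Definition _ := PseudoMetricNormedZmod.copy V' V.

Let sc (k : K) (v : V') : V' := Num.conj k *: (v : V).

Let scA a b v : sc a (sc b v) = sc (a * b) v.
Proof. by rewrite /sc scalerA rmorphM. Qed.

Let sc1 : left_id 1 sc.
Proof. by move=> v; rewrite /sc rmorph1 scale1r. Qed.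

Let scDr : right_distributive sc +%R.
Proof. by move=> k u v; rewrite /sc; exact: (@scalerDr K V). Qed.

Let scDl v : {morph sc^~ v : a b / a + b}.
Proof. by move=> a b; rewrite /sc rmorphD; exact: (@scalerDl K V). Qed.

HB.instance Definition _ := GRing.Zmodule_isLmodule.Build K V' scA sc1 scDr scDl.

Let norm_sc (k : K) (v : V') : `|k *: v| = `|k| * `|v|.
Proof. by rewrite -[LHS]/(`|Num.conj k *: (v : V)|) normrZ norm_conjC. Qed.

HB.instance Definition _ :=
  PseudoMetricNormedZmod_Lmodule_isNormedModule.Build K V' norm_sc.

End ConjSpace.

(** * Bounded linear extensions to projective tensor products *)

Section ProjectiveTensor.
Variables (R : realType) (V W : completeNormedModType R[i]) (P : projective_tensor V W).

Lemma gt0_complexE (e : R[i]) : 0 < e -> exists2 r : R, 0 < r & e = r%:C.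
Proof.
move=> e0; have /complex_realP[r er] := gtr0_real e0.
by exists r => //; move: e0; rewrite er ltcR.
Qed.

Lemma norm_le_linear_continuous (Z : completeNormedModType R[i]) (L : {linear V -> Z}) (c : R) :
  (forall z, `|L z| <= c%:C * `|z|) -> continuous L.
Proof.
move=> Lc; apply/linear_bounded_continuous/linear_boundedP.
near=> r => x; apply: (le_trans (Lc x)); rewrite ler_wpM2r//.
near: r; apply: nbhs_pinfty_ge.
by apply/complex_realP; exists c.
Unshelve. all: by end_near. Qed.

Lemma projective_extension (Z : completeNormedModType R[i]) (f : V -> W -> Z) (c : R) :
  0 <= c -> (forall w, linear (f ^~ w)) -> (forall v, linear (f v)) ->
  (forall v w, `|f v w| <= c%:C * (`|v| * `|w|)) ->
  exists L : {linear P -> Z},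
    (forall v w, L (tens P v w) = f v w) /\ forall z, `|L z| <= c%:C * `|z|.
Proof.
move=> c0 fl fr fc.
pose fB := bilinear_isBilinear.Build _ _ _ _ _ _ f (fl, fr).
pose g : {bilinear V -> W -> Z} := HB.pack f fB.
have [L [Lf Lc _]] := @tens_universal _ _ _ P Z g c fc.
by exists L; split => //; exact: Lc.
Qed.

End ProjectiveTensor.

(** * Norm continuity of the trace *)

(** No convergence is assumed: [limn] of a divergent sequence is [0]. *)
Lemma norm_lim_le (R : realType) (u : nat -> R[i]^o) (C : R[i]) :
  (forall n, `|u n| <= C) -> `|limn u| <= C.
Proof.
move=> uC; have C0 : 0 <= C by exact: le_trans (uC 0%N).
have [uc|ud] := pselect (cvgn u); last by rewrite (dvgP ud) normr0.
apply/ler_addgt0Pr => e e0.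
have /cvgrPdist_lt /(_ e e0) [N _ /(_ N (leqnn N)) /= uN] := uc.
rewrite -[X in `|X|](subrK (u N)) (le_trans (ler_normD _ _))// addrC lerD//.
exact: ltW.
Qed.

(** Cauchy-Schwarz in additive form, which can be summed directly along two square-summable
    sequences. *)
Lemma ip_norm_le (R : realType) (H : hilbert R) (x y : H) :
  `|ip H x y| *+ 2 <= `|x| ^+ 2 + `|y| ^+ 2.
Proof.
set d := ip H x y.
have [->|d0] := eqVneq d 0; first by rewrite normr0 mul0rn addr_ge0 ?exprn_ge0.
have nd0 : `|d| != 0 by rewrite normr_eq0.
pose w := d / `|d|.
have w1 : `|w| = 1 by rewrite normrM normfV normr_id divff.
have xwy : ip H x (w *: y) = `|d|.
  rewrite linearZr_LR/= -/d /w rmorphM fmorphV/= (CrealP (normr_real d)).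
  by rewrite mulrAC [X in X / _]mulrC -normCK expr2 mulfK.
(* Expand [0 <= |x - w y|^2], the phase [w] making [ip H x (w y)] real. *)
have := dnorm_ge0 (ip H) (x - w *: y).
rewrite dnormB xwy (CrealP (normr_real d)) !ip_norm normrZ w1 mul1r subr_ge0.
by rewrite mulr2n.
Qed.

Lemma ultraweak_functional_le (R : realType) (A : ncps R) (x y : nat -> nhilb A) :
  square_summable x -> square_summable y ->
  exists2 c : R, 0 <= c & forall (e : R) a, 0 < e -> `|a| <= e%:C ->
    `|ultraweak_functional (@nrep _ A) x y a| <= (c * e)%:C.
Proof.
move=> [cx hx] [cy hy]; exists (cx + cy).
  have := hx 0%N; have := hy 0%N; rewrite !big_ord0 !ler0c => h1 h2.
  exact: addr_ge0.
move=> e a e0 ae; apply: norm_lim_le => n.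
rewrite /series/= big_mkord (le_trans (ler_norm_sum _ _ _))//.
have e0' : 0 < e%:C :> R[i] by rewrite ltcR.
apply: (@le_trans _ _ (\sum_(k < n) e%:C * (`|x k| ^+ 2 + `|y k| ^+ 2))); last first.
  rewrite -mulr_sumr big_split/= mulrC rmorphM ler_wpM2r ?ler0c ?(ltW e0)//.
  by rewrite [leRHS]rmorphD; apply: lerD; [exact: hx|exact: hy].
apply: ler_sum => k _.
(* Dividing [a] by [e] makes it act as a contraction, so that the additive Cauchy-Schwarz bound,
   whose two terms scale differently, yields an estimate linear in [e]. *)
have -> : nrep a (x k) = e%:C *: nrep (e%:C^-1 *: a) (x k).
  have rl := rep_linearl (nrepP A).
  have rZ c (b : A) z : nrep (c *: b) z = c *: nrep b z.
    have r0 : nrep (0 : A) z = 0.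
      by have /esym/(canRL (addrK _)) := rl 1 0 0 z; rewrite scaler0 scale1r addr0 subrr.
    by have := rl c b 0 z; rewrite addr0 r0 addr0.
  by rewrite rZ scalerA divff ?scale1r// gt_eqF.
rewrite linearZl_LR/= normrM gtr0_norm// ler_wpM2l ?(ltW e0')//.
set z := nrep _ _.
have zx : `|z| <= `|x k|.
  apply: (le_trans (rep_bounded (nrepP A) _ _)).
  rewrite normrZ normfV gtr0_norm// -[leRHS]mul1r ler_wpM2r//.
  by rewrite ler_pdivrMl// mulr1.
rewrite (@le_trans _ _ (`|ip (nhilb A) z (y k)| *+ 2))//.
  by rewrite mulr2n lerDl.
by rewrite (le_trans (ip_norm_le _ _))// lerD// lerXn2r// nnegrE.
Qed.

(** Every ultraweak functional is norm continuous at 0, so the norm neighbourhoods of 0 converge to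
    0 ultraweakly. Hence [phi] is norm continuous at 0, and a linear map continuous at 0 is
    bounded. *)
Lemma phi_bounded (R : realType) (A : ncps R) :
  exists2 c : R, 0 <= c & forall a, `|phi A a| <= c%:C * `|a|.
Proof.
have p0 : {for 0, continuous (phi A)}.
  apply: (@phi_normal R A (nbhs (0 : A)) 0) => x y hx hy.
  have [c c0 hc] := ultraweak_functional_le hx hy.
  have u0 : ultraweak_functional (@nrep _ A) x y 0 = 0.
    apply/eqP; rewrite -normr_eq0 eq_le normr_ge0 andbT.
    apply/ler_addgt0Pr => _ /gt0_complexE[e e0 ->]; rewrite add0r.
    (* Here [c] may vanish, hence the denominator [c + 1]. *)
    have e'0 : 0 < e / (c + 1) by rewrite divr_gt0// ltr_wpDl.
    rewrite (le_trans (hc _ _ e'0 _))// ?normr0 ?lecR ?(ltW e'0)//.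
    by rewrite mulrCA ger_pMr// ler_pdivrMr ?mul1r ?lerDl// ltr_wpDl.
  rewrite u0; apply/cvgrPdist_le => _ /gt0_complexE[e e0 ->].
  have e'0 : 0 < e / (c + 1) by rewrite divr_gt0// ltr_wpDl.
  near=> a; rewrite sub0r normrN.
  have ae : `|a| <= (e / (c + 1))%:C.
    near: a; apply: nbhs0_le; by rewrite ltcR.
  rewrite (le_trans (hc _ _ e'0 ae))// lecR.
  by rewrite mulrCA ger_pMr// ler_pdivrMr ?mul1r ?lerDl// ltr_wpDl.
have /linear_boundedP := continuous_linear_bounded 0 p0.
move=> /pinfty_ex_gt0[r /gt0_complexE[c c0 ->] h].
by exists c => //; exact: ltW.
Unshelve. all: by end_near. Qed.

(** * The involution: isometry and compatibility with the trace *)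

Section CstarFacts.
Variables (R : realType) (A : cstarType R[i]).
Implicit Types a b c : A.

Lemma amul_linearl b : linear (fun a => a ∙ b).
Proof. by move=> k a a'; rewrite amulDl amulZl. Qed.

Lemma amul_linearr a : linear (amul a).
Proof. by move=> k b b'; rewrite amulDr amulZr. Qed.

Lemma star_aone : star (aone : A) = aone.
Proof. by rewrite -[LHS]amul1r -{2}(starK aone) -starM amul1r starK. Qed.

(** The C*-identity and submultiplicativity give [|b|^2 <= |star b| |b|]; this is applied to [a] and
    to [star a]. *)
Lemma norm_star a : `|star a| = `|a|.
Proof.
have le_star b : `|b| <= `|star b|.
  have [->|b0] := eqVneq b 0; first by rewrite normr0.
  by rewrite -(ler_pM2r (_ : 0 < `|b|)) ?normr_gt0// -expr2 -normCstar normM_le.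
by apply/eqP; rewrite eq_le -{2}(starK a) !le_star.
Qed.

End CstarFacts.

(** Polarization: positivity of [phi] at [a + k] times the unit forces the cross terms
    [k * v + Num.conj k * u] to be real. *)
Lemma phi_star (R : realType) (A : ncps R) (a : A) :
  phi A (star a) = Num.conj (phi A a : R[i]).
Proof.
set u : R[i] := phi A a; set v : R[i] := phi A (star a).
have key (k : R[i]) : k * v + Num.conj k * u \is Num.real.
  have -> : k * v + Num.conj k * u =
      phi A (star (a + k *: aone) ∙ (a + k *: aone)) - phi A (star a ∙ a) - `|k| ^+ 2.
    rewrite starD starZ star_aone amulDl !amulDr !amulZl !amulZr !amul1l !amul1r.
    rewrite !linearD !linearZ/= phi_unital -/u -/v /GRing.scale/= mulr1 normCK.
    by rewrite -[_ + k * v + _]addrA [_ + (k * v + _)]addrC addrK addrA (mulrC k (Num.conj k)) addrK.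
  by rewrite !realB ?ger0_real ?phi_positive ?exprn_ge0.
(* The choice [k = 1] makes [v + u] real and [k = i] makes [v - u] imaginary; adding the two
   relations gives [2 v = 2 conj u]. *)
have h1 := CrealP (key 1); have hi := CrealP (key 'i%R).
rewrite !rmorphD !rmorphM/= !conjCK !rmorph1 !mul1r !conjCi !mulNr in h1 hi.
rewrite -[X in _ = X]opprB -!mulrBr [X in X = _]addrC -mulrBr -mulrN in hi.
have {}hi := mulfI (neq0Ci R[i]) hi.
have h2 : v *+ 2 = Num.conj u *+ 2.
  transitivity ((v + u) + (v - u)); first by rewrite addrACA subrr addr0.
  transitivity ((Num.conj v + Num.conj u) + (Num.conj u - Num.conj v)).
    by rewrite h1 hi opprB.
  by rewrite [Num.conj v + _]addrC addrACA subrr addr0.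
by apply/eqP; rewrite -(eqr_pMn2r (_ : 0 < 2)%N)// h2.
Qed.

(** * The maps on tensors given by continuous extension *)

Section Extensions.
Variables (R : realType) (A : ncps R).
Variables (A2 : projective_tensor A A) (A3 : projective_tensor A2 A).

(** [ext2] is defined by choice, so exhibiting one extension [L] transfers the specification to the
    chosen map. *)
Lemma ext2P (Z : completeNormedModType R[i]) (f : A -> A -> Z) (L : A2 -> Z) :
  {morph L : x y / x + y} -> continuous L -> (forall a b, L (tens2 A2 a b) = f a b) ->
  [/\ {morph ext2 (A2 := A2) f : x y / x + y}, continuous (ext2 (A2 := A2) f)
    & forall a b, ext2 f (tens2 A2 a b) = f a b].
Proof.
move=> LD Lc Lf; rewrite /ext2; set P := (X in xget _ X).
by have : P (xget (fun=> 0) P) by apply: xgetPex; exists L.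
Qed.

Lemma ext3P (Z : completeNormedModType R[i]) (f : A -> A -> A -> Z) (L : A3 -> Z) :
  {morph L : x y / x + y} -> continuous L -> (forall a b c, L (tens3 A3 a b c) = f a b c) ->
  [/\ {morph ext3 (A3 := A3) f : x y / x + y}, continuous (ext3 (A3 := A3) f)
    & forall a b c, ext3 f (tens3 A3 a b c) = f a b c].
Proof.
move=> LD Lc Lf; rewrite /ext3; set P := (X in xget _ X).
by have : P (xget (fun=> 0) P) by apply: xgetPex; exists L.
Qed.

Lemma id_phi_extension : exists2 c : R, 0 <= c & exists L : {linear A2 -> A},
  (forall a b, L (tens2 A2 a b) = (phi A b : R[i]) *: a) /\
  (forall z, `|L z| <= c%:C * `|z|).
Proof.
have [c c0 hc] := phi_bounded A; exists c => //.
apply: projective_extension => //.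
- by move=> b k a a'; rewrite scalerDr !scalerA mulrC.
- by move=> a k b b'; rewrite linearP scalerDl scalerA.
- by move=> a b; rewrite normrZ mulrCA mulrC ler_wpM2l.
Qed.

Lemma id_phi_tens2 a b : id_phi (tens2 A2 a b) = (phi A b : R[i]) *: a.
Proof.
have [c _ [L [Lt Lc]]] := id_phi_extension.
have [_ _ h] := ext2P (raddfD L) (norm_le_linear_continuous Lc) Lt; exact: h.
Qed.

(** The extension is built in two stages: the bounded extension of [id_phi] on the first two
    factors, then multiplication by the third. *)
Lemma id_phi_idP :
  [/\ {morph @id_phi_id R A A2 A3 : x y / x + y}, continuous (@id_phi_id R A A2 A3)
    & forall a b c, id_phi_id (tens3 A3 a b c) = (phi A b : R[i]) *: (a ∙ c)].
Proof.
have [c c0 [L [Lt Lc]]] := id_phi_extension.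
have [|||M [Mt Mc]] := @projective_extension R A2 A A3 A (fun z a => L z ∙ a) c c0.
- by move=> a k z z'; rewrite linearP amul_linearl.
- by move=> z; exact: amul_linearr.
- move=> z a; rewrite (le_trans (normM_le _ _))// mulrA ler_wpM2r//.
apply: (@ext3P A _ M (raddfD M) (norm_le_linear_continuous Mc)) => a b d.
rewrite /= /tens3 Mt.
by rewrite Lt amulZl.
Qed.

Lemma star2_tens2 a b : star2 (tens2 A2 a b) = tens2 A2 (star b) (star a).
Proof.
(* The involution is conjugate-linear; with the conjugate space as target it becomes linear and the
   universal property applies. *)
pose f a b : conj_space A2 := tens2 A2 (star b) (star a).
have [|||L [Lt Lc]] := @projective_extension R A A A2 (conj_space A2) f 1 ler01.
- move=> v k x y; rewrite /f starD starZ.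
  by rewrite /tens2 linearDr linearZr_LR.
- move=> v k x y; rewrite /f starD starZ.
  by rewrite /tens2 linearDl linearZl_LR.
- move=> v w; rewrite mul1r mulrC -(norm_star v) -(norm_star w).
  exact: tens_norm.
have [_ _ h] := @ext2P A2 (fun a b => tens2 A2 (star b) (star a)) L (raddfD L)
  (norm_le_linear_continuous Lc) Lt.
exact: h.
Qed.

End Extensions.

(** * Uniqueness of extensions on the triple tensor product of a subalgebra *)

Section TripleTensors.
Variables (R : realType) (A : ncps R).
Variables (A2 : projective_tensor A A) (A3 : projective_tensor A2 A).

Lemma filtration0 (X : R -> A) (t : R) : filtration X t 0.
Proof.
move=> B _ [B1 BD _] _.
by have := BD (-1) _ _ B1 B1; rewrite scaleN1r addNr.
Qed.

(** The representing series has one nonzero term and is padded by zeros, which must belong to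
    [B]. *)
Lemma hat3_tens3 (B : set A) a b c : B 0 -> B a -> B b -> B c ->
  hat3 B (tens3 A3 a b c).
Proof.
move=> B0 Ba Bb Bc.
have /complex_realP[r rE] : `|a| * `|b| * `|c| \is Num.real by rewrite !realM.
exists r, (fun n => if n == 0%N then a else 0), (fun n => if n == 0%N then b else 0),
  (fun n => if n == 0%N then c else 0); split.
- by case.
- case=> [|n].
    by rewrite big_ord0 -rE !mulr_ge0.
  by rewrite big_ord_recl/= big1 ?addr0 ?rE// => i _; rewrite normr0 !mul0r.
- apply: cvg_near_cst; exists 1%N => // -[|n] // _.
  rewrite /series/= big_nat_recl//= big1 ?addr0// => i _.
  by rewrite /tens3 linear0r.
Qed.

(** The remainder of the series is represented by its own tail, whose mass [e n] is the tail of a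
    convergent series of nonnegative reals. *)
Lemma series_rep3_tail (B : set A) (r : R) (z : A3) (a b c : nat -> A) :
  (forall n, [/\ B (a n), B (b n) & B (c n)]) ->
  (forall n, \sum_(k < n) `|a k| * `|b k| * `|c k| <= r%:C) ->
  series (fun n => tens3 A3 (a n) (b n) (c n)) @ \oo --> z ->
  exists e : nat -> R, e @ \oo --> (0 : R) /\
    forall n, series_rep3 B (e n) (z - series (fun n => tens3 A3 (a n) (b n) (c n)) n).
Proof.
move=> Babc hr zE.
pose w k := complex.Re (`|a k| * `|b k| * `|c k|).
have wE k : `|a k| * `|b k| * `|c k| = (w k)%:C by rewrite RRe_real// !realM.
have w0 k : 0 <= w k by rewrite -ler0c -wE !mulr_ge0.
have hrw n : series w n <= r.
  rewrite -lecR (le_trans _ (hr n))// /series/= big_mkord rmorph_sum.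
  by under [leRHS]eq_bigr do rewrite wE.
have wnd : nondecreasing_seq (series w).
  by apply/nondecreasing_seqP => n; rewrite seriesEnat/= big_nat_recr//= lerDl.
have wc : cvgn (series w).
  by apply: nondecreasing_is_cvgn => //; exists r => _ [n _ <-].
exists (fun n => limn (series w) - series w n); split.
  by rewrite -(subrr (limn (series w))); apply: cvgB => //; exact: cvg_cst.
move=> n; exists (fun k => a (n + k)%N), (fun k => b (n + k)%N), (fun k => c (n + k)%N).
split => [k|m|]; first exact: Babc.
  under eq_bigr do rewrite wE.
  rewrite -rmorph_sum lecR lerBrDl.
  rewrite (le_trans _ (nondecreasing_cvgn_le wnd wc (n + m)%N))//.
  rewrite /series/= [leRHS](big_cat_nat _ (n := n))//= ?leq_addr// lerD2l.
  rewrite -{2}[n]add0n big_addn addKn big_mkord.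
  by under [leRHS]eq_bigr do rewrite addnC.
have -> : series (fun k => tens3 A3 (a (n + k)%N) (b (n + k)%N) (c (n + k)%N)) =
    (fun m => series (fun k => tens3 A3 (a k) (b k) (c k)) (m + n)%N
            - series (fun k => tens3 A3 (a k) (b k) (c k)) n).
  apply/funext => m; rewrite /series/= [X in X - _](big_cat_nat _ (n := n))//= ?leq_addl//.
  rewrite addrAC subrr add0r -{4}[n]add0n big_addn addnK.
  by under [RHS]eq_bigr do rewrite addnC.
by apply: cvgB; [rewrite (cvg_shiftn n (series (fun k => tens3 A3 (a k) (b k) (c k))))
                | exact: cvg_cst].
Qed.

(** [E] is controlled only by the masses of representations inside [B]. So a finite number of terms
    is split off by linearity, and the mass bound on the tail makes the rest vanish in the limit. *)
Lemma extends_on_eq (B : set A) (f : A -> A -> A -> A) (E h : A3 -> A) (z : A3) :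
  B 0 -> extends_on B f E ->
  {morph h : x y / x + y} -> continuous h ->
  (forall a b c, B a -> B b -> B c -> h (tens3 A3 a b c) = f a b c) ->
  hat3 B z -> E z = h z.
Proof.
move=> B0 [El [c Ec] Ef] hD hc hf [r [a1 [a2 [a3 [Ba ha za]]]]].
have h0 : h 0 = 0 by apply: (addIr (h 0)); rewrite -hD !add0r.
set S := series _ in za.
have [e [e0 he]] := series_rep3_tail Ba ha za.
have EzE n : E z = h (S n) + E (z - S n).
  elim: n => [|n ->].
    by rewrite /S /series/= big_geq// h0 add0r subr0.
  have [B1 B2 B3] := Ba n.
  have -> : z - S n = 1 *: tens3 A3 (a1 n) (a2 n) (a3 n) + (z - S n.+1).
    by rewrite scale1r /S [in RHS]/series/= big_nat_recr//= opprD addrCA [X in _ = z + X]addrC subrK.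
  rewrite El; [|exact: hat3_tens3|by exists (e n.+1); exact: he].
  rewrite scale1r addrA Ef// -hf// -hD; congr (h _ + _).
  by rewrite /S [in RHS]/series/= big_nat_recr.
have hSz : h (S n) @[n --> \oo] --> h z by apply: continuous_cvg => //; exact: hc.
have hSE : h (S n) @[n --> \oo] --> E z.
  apply/cvgrPdist_le => _ /gt0_complexE[d d0 ->].
  have /cvgrPdist_le/(_ d d0) : c * e n @[n --> \oo] --> c * 0 by apply: cvgMr.
  apply: filterS => n; rewrite mulr0 sub0r normrN => ce.
  rewrite (EzE n) addrAC subrr add0r (le_trans (Ec _ _ (he n)))// lecR.
  by rewrite (le_trans (ler_norm _)).
exact: (cvg_unique _ hSE hSz).
Qed.

End TripleTensors.

(** * Riemann integrals of additive interval functions *)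

Section RiemannIntegral.
Variables (R : realType) (V : completeNormedModType R[i]).

Lemma partition_homo (n : nat) (p : nat -> R) (i j : nat) :
  (forall k, (k < n)%N -> p k <= p k.+1) -> (i <= j)%N -> (j <= n)%N -> p i <= p j.
Proof.
move=> pS; elim: j => [|j IH]; first by rewrite leqn0 => /eqP ->.
rewrite leq_eqVlt => /predU1P[->//|]; rewrite ltnS => ij jn.
by rewrite (le_trans (IH ij (ltnW jn)))// pS.
Qed.

(** [D s t] splits along any partition, and the local errors, small relative to the lengths of the
    pieces, add up to a small multiple of [t - s]. *)
Lemma additive_riemann_integral (g : R -> V) (D : R -> R -> V) (s t : R) :
  (forall a b c, s <= a -> a <= b -> b <= c -> c <= t -> D a c = D a b + D b c) ->
  (forall e : R, 0 < e -> exists2 d : R, 0 < d & forall p c q,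
     s <= p -> p <= c -> c <= q -> q <= t -> q - p < d ->
     `|(q - p)%:C *: g c - D p q| <= (e * (q - p))%:C) ->
  s <= t -> is_riemann_integral g s t (D s t).
Proof.
move=> DD Dg st e e0.
(* The added 1 covers [s = t] and makes the final inequality strict. *)
have ts1 : 0 < t - s + 1 by rewrite ltr_wpDl// subr_ge0.
have [d d0 hd] := Dg (e / (t - s + 1)) (divr_gt0 e0 ts1).
exists d => // n p c p0 pn hpc.
have pS k : (k < n)%N -> p k <= p k.+1.
  by move=> /hpc[/andP[h1 h2] _]; exact: le_trans h1 h2.
have sp k : (k <= n)%N -> s <= p k.
  by rewrite -p0 => kn; apply: (partition_homo pS).
have pt k : (k <= n)%N -> p k <= t.
  by rewrite -pn => kn; apply: (partition_homo pS).
have Dsum k : (k <= n)%N -> D s (p k) = \sum_(i < k) D (p i) (p i.+1).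
  elim: k => [_|k IH kn].
    rewrite big_ord0 p0; apply: (addIr (D s s)).
    by rewrite add0r -DD.
  by rewrite big_ord_recr/= -IH ?(ltnW kn)// (DD s (p k))// ?sp ?pS ?pt// ltnW.
rewrite -pn Dsum// -sumrB (le_lt_trans (ler_norm_sum _ _ _))//.
apply: (@le_lt_trans _ _ (\sum_(k < n) (e / (t - s + 1) * (p k.+1 - p k))%:C)).
  apply: ler_sum => k _; have [/andP[h1 h2] h3] := hpc k (ltn_ord k).
  by apply: hd; rewrite ?sp ?pt// ltnW.
rewrite -rmorph_sum ltcR -mulr_sumr -(big_mkord xpredT (fun k => p k.+1 - p k)).
rewrite telescope_sumr// pn p0 mulrAC -mulrA gtr_pMr//.
by rewrite ltr_pdivrMr// mul1r ltrDl.
Qed.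

(** One uniform partition, tagged at left endpoints and finer than both required meshes, has a
    Riemann sum close to both values. *)
Lemma is_riemann_integral_unique (g : R -> V) (s t : R) (I J : V) : s <= t ->
  is_riemann_integral g s t I -> is_riemann_integral g s t J -> I = J.
Proof.
move=> st hI hJ; apply/eqP; rewrite -subr_eq0 -normr_eq0 eq_le normr_ge0 andbT.
apply/ler_addgt0Pr => _ /gt0_complexE[e e0 ->]; rewrite add0r.
have e20 : 0 < e / 2 by rewrite divr_gt0.
have [d1 d10 h1] := hI _ e20; have [d2 d20 h2] := hJ _ e20.
pose d := Num.min d1 d2; have d0 : 0 < d by rewrite lt_min d10.
(* The successor gives both [N > 0] and the strict bound [(t - s) / N < d]. *)
pose N := (Num.trunc ((t - s) / d)).+1.
have N0 : 0 < N%:R :> R by rewrite ltr0n.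
pose p (k : nat) := s + (t - s) * (k%:R / N%:R).
have p0 : p 0%N = s by rewrite /p mul0r mulr0 addr0.
have pN : p N = t by rewrite /p divff ?mulr1 1?addrC ?subrK// gt_eqF.
have pB k : p k.+1 - p k = (t - s) / N%:R.
  by rewrite /p opprD addrACA subrr add0r -mulrBr -mulrBl -natrB// subSnn mul1r.
have pd k : p k.+1 - p k < d.
  by rewrite pB ltr_pdivrMr// mulrC -ltr_pdivrMr// truncnS_gt.
have pS k : p k <= p k.+1 by rewrite -subr_ge0 pB divr_ge0 ?subr_ge0// ltW.
have H1 : (forall k, (k < N)%N -> p k <= p k <= p k.+1 /\ p k.+1 - p k < d1).
  by move=> k _; rewrite lexx pS; split=> //; rewrite (lt_le_trans (pd k))// ge_min lexx.
have H2 : (forall k, (k < N)%N -> p k <= p k <= p k.+1 /\ p k.+1 - p k < d2).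
  by move=> k _; rewrite lexx pS; split=> //; rewrite (lt_le_trans (pd k))// ge_min lexx orbT.
have := h1 N p p p0 pN H1; have := h2 N p p p0 pN H2.
set S := \sum_(_ < _) _ => SJ SI.
have -> : I - J = (S - J) - (S - I) by rewrite opprB [RHS]addrC subrKA.
rewrite (le_trans (ler_normB _ _))// [e]splitr rmorphD.
by apply: lerD; exact: ltW.
Qed.

Lemma riemann_integralE (g : R -> V) (s t : R) (I : V) : s <= t ->
  is_riemann_integral g s t I -> riemann_integral g s t = I.
Proof.
move=> st hI; apply: (is_riemann_integral_unique st _ hI).
exact: (xgetPex 0 (ex_intro _ I hI)).
Qed.

End RiemannIntegral.

(** * Small powers *)

Lemma powR_small (R : realType) (c a e : R) : 0 < a -> 0 < e ->
  exists2 d : R, 0 < d & forall x, 0 <= x -> x < d -> c * x `^ a <= e.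
Proof.
move=> a0 e0; have c10 : 0 < `|c| + 1 by rewrite ltr_wpDl.
have e'0 : 0 < e / (`|c| + 1) by rewrite divr_gt0.
(* This is the root [d] of [(|c| + 1) d^a = e]. *)
exists ((e / (`|c| + 1)) `^ a^-1); first exact: powR_gt0.
move=> x x0 xd; rewrite (@le_trans _ _ ((`|c| + 1) * x `^ a))//.
  by rewrite ler_wpM2r ?powR_ge0// (le_trans (ler_norm c))// lerDl.
rewrite mulrC -ler_pdivlMr//.
have -> : e / (`|c| + 1) = ((e / (`|c| + 1)) `^ a^-1) `^ a.
  by rewrite -powRrM mulVf ?powRr1 ?gt_eqF// ltW.
by rewrite ge0_ler_powR ?nnegrE ?powR_ge0// ltW.
Qed.

Lemma powR_little_o (R : realType) (c mu e : R) : 1 < mu -> 0 < e ->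
  exists2 d : R, 0 < d & forall x, 0 < x -> x < d -> c * x `^ mu <= e * x.
Proof.
move=> mu1 e0; have mu10 : 0 < mu - 1 by rewrite subr_gt0.
have [d d0 hd] := powR_small c mu10 e0.
exists d => // x x0 xd.
rewrite -{1}(subrK 1 mu) powRD; last by rewrite (gt_eqF x0) implybT.
by rewrite powRr1 ?mulrA ?ler_wpM2r ?hd// ltW.
Qed.

(** * Difference of the Stratonovich and Itô areas and of their extensions *)

Section RoughIntegralFacts.
Variables (R : realType) (A : ncps R).
Variables (A2 : projective_tensor A A) (A3 : projective_tensor A2 A).

Lemma extends_on_diff (B : set A) (f g : A -> A -> A -> A) (E F : A3 -> A) :
  extends_on B f E -> extends_on B g F ->
  extends_on B (fun a b c => f a b c - g a b c) (fun z => E z - F z).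
Proof.
move=> [El [cE Ec] Ef] [Fl [cF Fc] Ff]; split.
- by move=> k y z hy hz; rewrite El// Fl// scalerBr opprD addrACA.
- exists (cE + cF) => r z hz; rewrite (le_trans (ler_normB _ _))//.
  by rewrite mulrDl rmorphD lerD ?Ec ?Fc.
- by move=> a b c Ba Bb Bc; rewrite Ef ?Ff.
Qed.

Lemma strat_area_diff (XI : R -> R -> A2 -> A) (s t : R) (a b : A) :
  strat_area XI s t (tens2 A2 a b) - XI s t (tens2 A2 a b) =
    ((t - s) / 2)%:C *: ((phi A b : R[i]) *: a).
Proof. by rewrite /strat_area id_phi_tens2 addrAC subrr add0r. Qed.

(** [star2] swaps the factors, so the trace now falls on the first one; the outer [star] undoes the
    conjugation, because [phi] is hermitian and [(t - s) / 2] is real. *)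
Lemma strat_area_star_diff (XI : R -> R -> A2 -> A) (s t : R) (a b : A) :
  area_star (strat_area XI) s t (tens2 A2 a b) - area_star XI s t (tens2 A2 a b) =
    ((t - s) / 2)%:C *: ((phi A a : R[i]) *: b).
Proof.
rewrite /area_star /strat_area starD addrAC subrr add0r star2_tens2 id_phi_tens2.
by rewrite !starZ starK phi_star conjCK (CrealP _)//; apply/complex_realP; exists ((t - s) / 2).
Qed.

(** On elementary tensors the difference is [(t - s) / 2] times [phi b] times the product of [a] and
    [c]; uniqueness of extensions does the rest. *)
Lemma strat_extension_diff (X : R -> A) (XI : R -> R -> A2 -> A) (s t : R)
    (ES EI : A3 -> A) (z : A3) :
  extends_on (filtration X s) (fun a b c => strat_area XI s t (tens2 A2 a b) ∙ c) ES ->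
  extends_on (filtration X s) (fun a b c => XI s t (tens2 A2 a b) ∙ c) EI ->
  hat3 (filtration X s) z ->
  ES z - EI z = ((t - s) / 2)%:C *: id_phi_id z.
Proof.
move=> hS hI; have [hD hc ht] := id_phi_idP A3.
apply: (extends_on_eq (h := fun z => ((t - s) / 2)%:C *: id_phi_id z) _
          (extends_on_diff hS hI)).
- exact: filtration0.
- by move=> x y; rewrite hD scalerDr.
- by move=> x; apply: cvgZr; exact: hc.
- move=> a b c _ _ _; rewrite ht -amulZl -amulZl -(strat_area_diff XI) amulDl.
  by congr (_ + _); rewrite -scaleN1r amulZl scaleN1r.
Qed.

(** In [area_star] the trace hits the first factor of [b ⊗ c], again the middle one of the triple,
    hence the same correction as for the other extension. *)
Lemma strat_extension_star_diff (X : R -> A) (XI : R -> R -> A2 -> A) (s t : R)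
    (ES EI : A3 -> A) (z : A3) :
  extends_on (filtration X s)
    (fun a b c => a ∙ area_star (strat_area XI) s t (tens2 A2 b c)) ES ->
  extends_on (filtration X s) (fun a b c => a ∙ area_star XI s t (tens2 A2 b c)) EI ->
  hat3 (filtration X s) z ->
  ES z - EI z = ((t - s) / 2)%:C *: id_phi_id z.
Proof.
move=> hS hI; have [hD hc ht] := id_phi_idP A3.
apply: (extends_on_eq (h := fun z => ((t - s) / 2)%:C *: id_phi_id z) _
          (extends_on_diff hS hI)).
- exact: filtration0.
- by move=> x y; rewrite hD scalerDr.
- by move=> x; apply: cvgZr; exact: hc.
- move=> a b c _ _ _; rewrite ht -amulZr -amulZr -(strat_area_star_diff XI) amulDr.
  by congr (_ + _); rewrite -scaleN1r amulZr scaleN1r.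
Qed.

End RoughIntegralFacts.

(** * Small-interval estimates and additivity of the integral *)

Lemma holder_modulus (R : realType) (T al e : R) (V : completeNormedModType R[i])
    (g : R -> V) : 0 < al -> C1_holder T al g -> 0 < e ->
  exists2 d : R, 0 < d & forall s t, 0 <= s -> s <= t -> t <= T -> t - s < d ->
    `|g t - g s| <= e%:C.
Proof.
move=> al0 [_ [c hc]] e0; have [d d0 hd] := powR_small c al0 e0.
exists d => // s t s0; rewrite le_eqVlt => /predU1P[<- _ _|st tT std].
  by rewrite subrr normr0 ler0c ltW.
by rewrite (le_trans (hc _ _ s0 st tT))// lecR hd// subr_ge0 ltW.
Qed.

Lemma sewing_little_o (R : realType) (T e : R) (V : completeNormedModType R[i])
    (h : R -> R -> R -> V) (L : R -> R -> V) : is_sewing T h L -> 0 < e ->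
  exists2 d : R, 0 < d & forall s t, 0 <= s -> s <= t -> t <= T -> t - s < d ->
    `|L s t| <= (e * (t - s))%:C.
Proof.
move=> [mu [mu1 [_ _ [[_ L0] [c hc]] _]]] e0.
have [d d0 hd] := powR_little_o c mu1 e0.
exists d => // s t s0; rewrite le_eqVlt => /predU1P[<- sT _|st tT std].
  (* The Hölder bound is stated for [s < t] only; on the diagonal [L] vanishes. *)
  by rewrite L0 ?s0// subrr mulr0 normr0.
by rewrite (le_trans (hc _ _ s0 st tT))// lecR hd// subr_gt0.
Qed.

(** Subtracting [L] cancels the defect of additivity of [M], since both have the same [delta2]. *)
Lemma rough_integral_additive (R : realType) (T : R) (V : completeNormedModType R[i])
    (J M L : R -> R -> V) :
  is_sewing T (delta2 M) L ->
  (forall s t, 0 <= s -> s <= t -> t <= T -> J s t = M s t - L s t) ->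
  forall s u t, 0 <= s -> s <= u -> u <= t -> t <= T -> J s t = J s u + J u t.
Proof.
move=> [_ [_ [_ _ _ dL]]] JE s u t s0 su ut tT.
have [st uT u0] := And3 (le_trans su ut) (le_trans ut tT) (le_trans s0 su).
have := dL s u t (And4 s0 su ut tT); rewrite /delta2 -!addrA -!opprD => /esym/eqP.
rewrite subr_eq => /eqP ME; rewrite !JE// ME [RHS]addrACA -opprD.
by rewrite -[X in X - _]addrA [LHS]addrAC subrr add0r [LHS]addrC.
Qed.

Lemma additive_uniform (R : realType) (V W : completeNormedModType R[i]) (h : V -> W) (e : R) :
  {morph h : x y / x + y} -> continuous h -> 0 < e ->
  exists2 d : R, 0 < d & forall x y, `|x - y| <= d%:C -> `|h x - h y| <= e%:C.
Proof.
move=> hD hc e0; have h0 : h 0 = 0 by apply: (addIr (h 0)); rewrite -hD !add0r.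
have e'0 : 0 < e%:C :> R[i] by rewrite ltcR.
have /cvgrPdist_le/(_ _ e'0)/nbhs_norm0P[_ /gt0_complexE[d d0 ->] hd] := hc 0.
(* Halving turns the non-strict hypothesis into the strict one defining the ball. *)
exists (d / 2); first by rewrite divr_gt0.
move=> x y xy; have -> : h x - h y = h (x - y) by rewrite -{1}(subrK y x) hD addrK.
have /= := hd (x - y); rewrite h0 sub0r normrN; apply.
by rewrite (le_lt_trans xy)// ltcR ltr_pdivrMr// ltr_pMr// ltr1n.
Qed.

(** * Comparison of the two integrals *)

Theorem proposition5p6 (R : realType) (A : ncps R)
    (A2 : projective_tensor A A) (A3 : projective_tensor A2 A)
    (X : R -> A) (hX : free_brownian_motion X)
    (T gamma : R) (hT : 0 < T) (hgamma : 1 / 3 < gamma <= 1 / 2)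
    (XI : R -> R -> A2 -> A) (hXI : ito_area X T XI)
    (U : R -> A2) (U1 U2 : R -> A3) (Uflat : R -> R -> A2)
    (hU : controlled X T gamma U U1 U2 Uflat)
    (JI JS : R -> R -> A)
    (hJI : is_rough_integral X T XI U U1 U2 JI)
    (hJS : is_rough_integral X T (strat_area XI) U U1 U2 JS)
    (s t : R) (hs : 0 <= s) (hst : s < t) (ht : t <= T) :
  JS s t = JI s t
    + (2^-1)%:C *: riemann_integral (fun u => id_phi_id (U1 u + U2 u)) s t.
Proof.
have [EI1 [EI2 [LI [hEI1 hEI2 hLI JIE]]]] := hJI.
have [ES1 [ES2 [LS [hES1 hES2 hLS JSE]]]] := hJS.
have [phiD phic _] := id_phi_idP A3.
set G := fun u => id_phi_id (U1 u + U2 u).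
have gamma0 : 0 < gamma by case/andP: hgamma => + _; apply: lt_trans; rewrite divr_gt0.
(* The terms [sharp2 (U p) (delta1 X p q)] cancel, and each of the two area terms contributes its
   correction, to [U1 p] and [U2 p] respectively. *)
have JE p q : 0 <= p -> p <= q -> q <= T ->
    JS p q - JI p q = ((q - p) / 2)%:C *: G p - (LS p q - LI p q).
  move=> p0 pq qT; have pT : 0 <= p <= T by rewrite p0 (le_trans pq).
  have D1 := strat_extension_diff (hES1 _ _ p0 pq qT) (hEI1 _ _ p0 pq qT)
    (ctl_adapted1 hU pT).
  have D2 := strat_extension_star_diff (hES2 _ _ p0 pq qT) (hEI2 _ _ p0 pq qT)
    (ctl_adapted2 hU pT).
  rewrite JSE// JIE// /G phiD scalerDr -D1 -D2.
  set x := sharp2 _ _; set a := ES1 _ _ _; set b := ES2 _ _ _.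
  rewrite [in LHS]opprD addrACA [in RHS]opprD; congr (_ + _).
  rewrite opprD addrACA; congr (_ + _).
  by rewrite opprD addrACA subrr add0r.
suff hI : is_riemann_integral G s t (2%:C *: (JS s t - JI s t)).
  rewrite (riemann_integralE (ltW hst) hI) scalerA -rmorphM mulVf//.
  by rewrite scale1r addrC subrK.
have JSD := rough_integral_additive hLS JSE.
have JID := rough_integral_additive hLI JIE.
apply: (additive_riemann_integral (D := fun p q => 2%:C *: (JS p q - JI p q))) (ltW hst).
  move=> a b c sa ab bc ct.
  have a0 := le_trans hs sa; have cT := le_trans ct ht.
  by rewrite (JSD a b c)// (JID a b c)// opprD addrACA scalerDr.
move=> e e0.
(* Error budget: [e / 2] for moving the tag of [G] from [c] to [p], and [e / 8] for each sewing
   term, doubled by the factor 2. *)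
have e2 : 0 < e / 2 by rewrite divr_gt0.
have e8 : 0 < e / 8 by rewrite divr_gt0.
have [eta eta0 heta] := additive_uniform phiD phic e2.
have eta2 : 0 < eta / 2 by rewrite divr_gt0.
have [d1 d10 h1] := holder_modulus gamma0 (ctl_holder1 hU) eta2.
have [d2 d20 h2] := holder_modulus gamma0 (ctl_holder2 hU) eta2.
have [d3 d30 h3] := sewing_little_o hLS e8.
have [d4 d40 h4] := sewing_little_o hLI e8.
exists (Num.min (Num.min d1 d2) (Num.min d3 d4)); first by rewrite !lt_min d10 d20 d30 d40.
move=> p c q sp pc cq qt; rewrite !lt_min => /andP[/andP[qd1 qd2] /andP[qd3 qd4]].
have p0 := le_trans hs sp; have qT := le_trans qt ht; have pq := le_trans pc cq.
have cT := le_trans cq qT.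
have cpq : c - p <= q - p by rewrite lerD2r.
(* The quantity to bound becomes [(q - p) (G c - G p) + 2 (LS p q - LI p q)]. *)
rewrite JE// scalerBr scalerA -rmorphM mulrCA divff// mulr1.
rewrite opprB addrA addrAC -scalerBr.
have -> : e * (q - p) = (q - p) * (e / 2) + 2 * (e / 8 * (q - p) + e / 8 * (q - p)) by field.
have qp0 : 0 <= q - p by rewrite subr_ge0.
rewrite [leRHS]rmorphD (le_trans (ler_normD _ _))//.
apply: lerD; rewrite normrZ [leRHS]rmorphM ger0_norm ?ler0c// ler_wpM2l ?ler0c//.
  rewrite heta// opprD addrACA (le_trans (ler_normD _ _))//.
  rewrite [eta]splitr [leRHS]rmorphD; apply: lerD.
    by rewrite h1// (le_lt_trans cpq).
  by rewrite h2// (le_lt_trans cpq).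
rewrite (le_trans (ler_normB _ _))// [leRHS]rmorphD; apply: lerD.
  by rewrite h3.
by rewrite h4.
Qed.
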